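(* Let $G$, $H$ and $J$ be affine games. Then: (1) $G+(H+J)$ and $(G+H)+J$ are either equal or both undefined; (2) $G+H$ and $H+G$ are either equal or both undefined.
   Context: Affine games are defined recursively. There are two games without options, denoted $\infty$ and $\overline{\infty}$ (the affine games of day $-1$). Every other affine game is a form $G=\{G^{\mathcal L}\mid G^{\mathcal R}\}$, where $G^{\mathcal L}$ (the set of Left options) and $G^{\mathcal R}$ (the set of Right options) are non-empty finite sets of previously constructed affine games. Disjunctive sum (a partial operation): $G+H$ is not defined if one of $G,H$ is the form $\infty$ and the other is the form $\overline{\infty}$; $G+H=\infty$ if one of them is $\infty$ and the other is not $\overline\infty$; $G+H=\overline\infty$ if one of them is $\overline\infty$ and the other is not $\infty$; otherwise, recursively, $G+H=\{G^{\mathcal L}+H,\,G+H^{\mathcal L}\mid G^{\mathcal R}+H,\,G+H^{\mathcal R}\}$, where $G^{\mathcal L}+H,\,G+H^{\mathcal L}$ means $\{G^L+H: G^L\in G^{\mathcal L}\}\cup\{G+H^L: H^L\in H^{\mathcal L}\}$, and similarly for Right. A compound expression is undefined if one of its sub-sums is undefined. Here ''equal'' means equal as game forms (identical sets of options, recursively). *)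

(* Defs.v *)
From mathcomp Require Import all_boot.

Set Implicit Arguments.
Unset Strict Implicit.
Unset Printing Implicit Defensive.

(* A finite set of options is represented by a list; order and repetitions are
   forgotten by [form_eq] below, hereditarily. *)
Inductive form : Type :=
| Infty                          (* $\infty$ *)
| InftyBar                       (* $\overline{\infty}$ *)
| Form of seq form & seq form.

Fixpoint affine (G : form) : bool :=
  match G with
  | Infty | InftyBar => true
  | Form GL GR =>
      [&& ~~ nilp GL, ~~ nilp GR, all affine GL & all affine GR]
  end.

(* Equality of game forms: the two sets of Left options, and the two sets of
   Right options, are included in one another up to [form_eq]. *)
Fixpoint form_eq (G H : form) {struct G} : bool :=
  match G, H with
  | Infty, Infty => true
  | InftyBar, InftyBar => true
  | Form GL GR, Form HL HR =>
      [&& all (fun g => has (fun h => form_eq g h) HL) GL,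
          all (fun h => has (fun g => form_eq g h) GL) HL,
          all (fun g => has (fun h => form_eq g h) HR) GR &
          all (fun h => has (fun g => form_eq g h) GR) HR]
  | _, _ => false
  end.

Definition all_defined (T : Type) (s : seq (option T)) : option (seq T) :=
  if all isSome s then Some (pmap id s) else None.

(* Disjunctive sum; [None] means undefined. An undefined sum among the options
   makes the whole sum undefined. *)
Fixpoint gadd (G : form) : form -> option form :=
  fix gadd_G (H : form) : option form :=
    match G, H with
    | Infty, InftyBar | InftyBar, Infty => None
    | Infty, _ | _, Infty => Some Infty
    | InftyBar, _ | _, InftyBar => Some InftyBar
    | Form GL GR, Form HL HR =>
        let L := [seq gadd g H | g <- GL] ++ [seq gadd_G h | h <- HL] in
        let R := [seq gadd g H | g <- GR] ++ [seq gadd_G h | h <- HR] in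
        match all_defined L, all_defined R with
        | Some SL, Some SR => Some (Form SL SR)
        | _, _ => None
        end
    end.

Definition equal_or_both_undefined (x y : option form) : Prop :=
  match x, y with
  | Some G, Some H => form_eq G H
  | None, None => True
  | _, _ => False
  end.

(* Main.v *)
From Stdlib Require List.
Require Import Defs.
From mathcomp Require Import all_boot.

(** A sum of two forms with options only ever moves to sums with at least one
    term that has options, so a sum is undefined only if its two terms are the
    two opposite infinities. Completing the partial sum by [Infty] there gives
    an operation that is associative with Leibniz equality (both bracketings
    list the options of a triple sum in the same order) and commutative up to
    the order of the options. *)

(** Options sit inside lists, so the induction hypotheses go through list membership; [List.In] is
    used since [form] is given no [eqType] structure. *)
Lemma form_ind_In (P : form -> Prop) :
  P Infty -> P InftyBar ->
  (forall GL GR, (forall g, List.In g GL -> P g) ->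
     (forall g, List.In g GR -> P g) -> P (Form GL GR)) ->
  forall G, P G.
Proof.
move=> P1 P2 PF; fix IH 1 => -[||GL GR]; [exact: P1 | exact: P2 |].
(* [apply: id] keeps [done] from closing [P x] by an unguarded [IH x]. *)
apply: PF; [elim: GL => [x []|g s IHs x [<-|/IHs]] |
            elim: GR => [x []|g s IHs x [<-|/IHs]]];
  first [exact: (IH g) | apply: id].
Qed.

Lemma all_In {T : Type} {a : pred T} {s : seq T} :
  (forall x, List.In x s -> a x) -> all a s.
Proof.
elim: s => //= x s IHs Ha; rewrite Ha /=; last by left.
by apply: IHs => y ys; apply: Ha; right.
Qed.

Lemma has_In {T : Type} {a : pred T} {s : seq T} {x : T} :
  List.In x s -> a x -> has a s.
Proof. by elim: s => //= y s IHs [-> ->|/IHs xs /xs ->]; rewrite ?orbT. Qed.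

Lemma eq_map_In {T U : Type} {f g : T -> U} {s : seq T} :
  (forall x, List.In x s -> f x = g x) -> map f s = map g s.
Proof. exact: List.map_ext_in. Qed.

Lemma form_eq_refl (G : form) : form_eq G G.
Proof.
elim/form_ind_In: G => //= GL GR IHL IHR.
apply/and4P; split; apply: all_In => g gs; apply: (has_In gs); by auto.
Qed.

Fixpoint total_add (G : form) : form -> form :=
  fix total_add_G (H : form) : form :=
    match G, H with
    | Infty, _ | _, Infty => Infty
    | InftyBar, _ | _, InftyBar => InftyBar
    | Form GL GR, Form HL HR =>
        Form ([seq total_add g H | g <- GL] ++ [seq total_add_G h | h <- HL])
             ([seq total_add g H | g <- GR] ++ [seq total_add_G h | h <- HR])
    end.

Definition opposite_infinities (G H : form) : bool :=
  match G, H with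
  | Infty, InftyBar | InftyBar, Infty => true
  | _, _ => false
  end.

Lemma total_add_Form (GL GR HL HR : seq form) :
  let G := Form GL GR in let H := Form HL HR in
  total_add G H =
  Form ([seq total_add g H | g <- GL] ++ [seq total_add G h | h <- HL])
       ([seq total_add g H | g <- GR] ++ [seq total_add G h | h <- HR]).
Proof. by []. Qed.

Lemma gadd_Form (GL GR HL HR : seq form) :
  let G := Form GL GR in let H := Form HL HR in
  gadd G H =
  match all_defined ([seq gadd g H | g <- GL] ++ [seq gadd G h | h <- HL]),
        all_defined ([seq gadd g H | g <- GR] ++ [seq gadd G h | h <- HR]) with
  | Some SL, Some SR => Some (Form SL SR)
  | _, _ => None
  end.
Proof. by []. Qed.

Lemma all_defined_map_Some (T : Type) (s : seq T) :
  all_defined (map Some s) = Some s.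
Proof.
rewrite /all_defined all_map; have -> : all (preim Some isSome) s by elim: s.
by rewrite map_pK.
Qed.

Lemma gaddE (G H : form) :
  gadd G H = if opposite_infinities G H then None else Some (total_add G H).
Proof.
elim/form_ind_In: G H => [||GL GR IGL IGR]; try by case.
elim/form_ind_In => // HL HR IHL IHR.
have splitE (s t : seq form) :
    (forall g, List.In g s ->
       gadd g (Form HL HR) = Some (total_add g (Form HL HR))) ->
    (forall h, List.In h t ->
       gadd (Form GL GR) h = Some (total_add (Form GL GR) h)) ->
    [seq gadd g (Form HL HR) | g <- s] ++ [seq gadd (Form GL GR) h | h <- t] =
    map Some ([seq total_add g (Form HL HR) | g <- s] ++
              [seq total_add (Form GL GR) h | h <- t]).
  by move=> /eq_map_In-> /eq_map_In->; rewrite map_cat -!map_comp.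
(* Every option of the sum keeps one of the two given forms as a term. With that form on the left,
   [opposite_infinities] is false by computation. *)
have isF x : opposite_infinities x (Form HL HR) = false by case: x.
rewrite gadd_Form (splitE GL HL) ?(splitE GR HR) ?all_defined_map_Some //.
all: by move=> x xs; rewrite ?(IGL x xs) ?(IGR x xs) ?(IHL x xs) ?(IHR x xs) ?isF.
Qed.

Lemma total_addA : associative total_add.
Proof.
elim/form_ind_In => [||GL GR IGL IGR]; try by do 2![case=> [||? ?]].
elim/form_ind_In => [||HL HR IHL IHR]; try by case.
elim/form_ind_In => [||JL JR IJL IJR] //.
(* Both bracketings are expanded, then the inner sums that survive within the options are folded
   back, to match the induction hypotheses. *)
rewrite (total_add_Form HL) (total_add_Form GL GR HL) !total_add_Form.
rewrite -(total_add_Form HL) -(total_add_Form GL GR HL).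
rewrite !map_cat -!map_comp -!catA.
(* On each side the options form three blocks, for a move in the first, second or third term. *)
by congr (Form (_ ++ (_ ++ _)) (_ ++ (_ ++ _))); apply: eq_map_In => x xs;
  [apply: IGL | apply: IHL | apply: IJL | apply: IGR | apply: IHR | apply: IJR].
Qed.

Lemma total_addC_form_eq (G H : form) :
  form_eq (total_add G H) (total_add H G).
Proof.
elim/form_ind_In: G H => [||GL GR IGL IGR]; try by case.
elim/form_ind_In => [||HL HR IHL IHR] //.
rewrite !total_add_Form.
(* The same move gives an option in opposite blocks of the two sums, so [x] itself is the witness,
   found in the other block. *)
by apply/and4P; split; rewrite all_cat !all_map; apply/andP; split;
  apply: all_In => x xs /=; rewrite has_cat !has_map; apply/orP;
  solve [right; apply: (has_In xs) => /=; auto | left; apply: (has_In xs) => /=; auto].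
Qed.

Theorem theorem5 (G H J : form)
    (hG : affine G) (hH : affine H) (hJ : affine J) :
  equal_or_both_undefined
    (obind (fun HJ => gadd G HJ) (gadd H J))
    (obind (fun GH => gadd GH J) (gadd G H)) /\
  equal_or_both_undefined (gadd G H) (gadd H G).
Proof.
split; last first.
  have := total_addC_form_eq G H; rewrite !gaddE.
  by case: G {hG} => [||? ?]; case: H {hH}.
have -> : obind (fun HJ => gadd G HJ) (gadd H J) =
          obind (fun GH => gadd GH J) (gadd G H).
  rewrite !gaddE.
  (* Either bracketing is undefined exactly when both infinities occur among the three terms. *)
  case: G {hG} => [||? ?]; case: H {hH} => [||? ?]; case: J {hJ} => [||? ?] //;
    by rewrite /opposite_infinities /obind /oapp !gaddE ?total_addA.
by case: obind => //= K; exact: form_eq_refl.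
Qed.
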